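(* If $U\subseteq\mathbb{R}^2$ is any subset, then $\operatorname{tconv}\operatorname{conv}U=\operatorname{conv}\operatorname{tconv}U$.
   Context: Tropical semiring: $x\oplus y=\min(x,y)$ and $x\odot y=x+y$. For $c\in\mathbb{R}$ and $x\in\mathbb{R}^n$, $c\odot x=(c+x_1,\dots,c+x_n)$, and $\oplus$ of vectors is the coordinatewise minimum. A set $U\subseteq\mathbb{R}^n$ is tropically convex if $(c\odot x)\oplus(d\odot y)\in U$ for all $x,y\in U$ and all $c,d\in\mathbb{R}$ with $\min(c,d)=0$. The tropical convex hull $\operatorname{tconv}U$ is the smallest tropically convex set containing $U$. For finite $V=\{v_1,\dots,v_k\}$ it equals $\{c_1\odot v_1\oplus\cdots\oplus c_k\odot v_k:\min_i c_i=0\}$, and in general $\operatorname{tconv}U$ is the union of $\operatorname{tconv}V$ over finite $V\subseteq U$. $\operatorname{conv}$ denotes the ordinary convex hull. *)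

(* Defs.v *)
From mathcomp Require Import all_boot all_order all_algebra.
From mathcomp Require Import boolp classical_sets reals convex.

Set Implicit Arguments.
Unset Strict Implicit.
Unset Printing Implicit Defensive.

Import Order.TTheory GRing.Theory Num.Theory.

Local Open Scope classical_set_scope.
Local Open Scope ring_scope.

Definition trop_scale (R : realType) (n : nat) (c : R) (x : 'rV[R]_n) :
  'rV[R]_n := \row_i (c + x ord0 i).

Definition trop_add (R : realType) (n : nat) (x y : 'rV[R]_n) : 'rV[R]_n :=
  \row_i Num.min (x ord0 i) (y ord0 i).

Definition trop_convex (R : realType) (n : nat) (U : set 'rV[R]_n) : Prop :=
  forall (x y : 'rV[R]_n) (c d : R), U x -> U y -> Num.min c d = 0 ->
    U (trop_add (trop_scale c x) (trop_scale d y)).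

Definition tconv (R : realType) (n : nat) (U : set 'rV[R]_n) : set 'rV[R]_n :=
  smallest (@trop_convex R n) U.

(* [convex_set] is stated on the alias [convex_lmodType M] of an [lmodType] [M];
   the annotations make the hull a set of plain row vectors. *)
Definition conv_hull (R : realType) (n : nat) (U : set 'rV[R]_n) :
  set 'rV[R]_n :=
  smallest (fun A : set 'rV[R]_n => @convex_set R 'rV[R]_n A) U.

(* Main.v *)
(** Work in homogeneous coordinates [(0, x_0, ..., x_(n-1))] modulo tropical
    scaling, and let the [i]-th sector at [z] be the set of the [s] for which
    [s - z] has a minimal [i]-th coordinate. In every dimension, [z] lies in
    [tconv U] iff [U] meets all the sectors at [z]; since sectors are compatible
    with convex combinations, the tropical hull of a convex set is convex.

    In the plane, let [T] be tropically convex with convex hull [K], and let [K]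
    meet all the sectors at [z]. If [T] meets them too, then [z] is in [T].
    Otherwise [T] misses a sector at [z] that [K] meets, and a tropical segment
    of [T] yields a point [q] on the ray from [z] opposite to this sector. If
    [z] were not in [K], the part of [K] outside the sector would be convex: a
    segment leaving this part crosses, inside the sector, the line through [q]
    and [z], and [z] is between [q] and the crossing. This part contains [T], so
    it would be all of [K]. *)
From HB Require Import structures.
Require Import Defs.
From mathcomp Require Import all_boot all_order all_algebra.
From mathcomp Require Import boolp classical_sets reals convex.
From mathcomp Require Import interval_inference ring lra.

Set Implicit Arguments.
Unset Strict Implicit.
Unset Printing Implicit Defensive.

Import Order.TTheory GRing.Theory Num.Theory.

Local Open Scope classical_set_scope.
Local Open Scope ring_scope.

Section ConvexSets.
Variables (R : numDomainType) (V : lmodType R).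
Implicit Types (A B : set V) (f : {scalar V}).

Lemma convex_setP A : convex_set A <->
  (forall x y (p : R), A x -> A y -> 0 <= p -> p <= 1 ->
     A (p *: x + (1 - p) *: y)).
Proof.
split=> [cA x y p Ax Ay p0 p1|cA x y p].
  exact: (set_mem (cA x y (Itv01 p0 p1) (mem_set Ax) (mem_set Ay))).
by move=> /set_mem Ax /set_mem Ay; apply/mem_set; exact: cA.
Qed.

Lemma convex_bigcap (I : Type) (D : set I) (F : I -> set V) :
  (forall i, D i -> convex_set (F i)) -> convex_set (\bigcap_(i in D) F i).
Proof.
move=> cF; apply/convex_setP => x y p Fx Fy p0 p1 i Di.
by move/convex_setP: (cF i Di); apply=> //; [exact: Fx|exact: Fy].
Qed.

Lemma convex_setI A B : convex_set A -> convex_set B -> convex_set (A `&` B).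
Proof.
move=> /convex_setP cA /convex_setP cB; apply/convex_setP.
by move=> x y p [Ax Bx] [Ay By] p0 p1; split; [exact: cA|exact: cB].
Qed.

Lemma scalar_conv f (x y : V) (p : R) :
  f (p *: x + (1 - p) *: y) = p * f x + (1 - p) * f y.
Proof. by rewrite linearD !linearZ. Qed.

Lemma convex_hyperplane f (c : R) : convex_set [set x | f x = c].
Proof.
by apply/convex_setP => x y p /= fx fy _ _; rewrite scalar_conv fx fy; ring.
Qed.

End ConvexSets.

Section Halfspaces.
Variables (R : realFieldType) (V : lmodType R).
Implicit Types (A : set V) (f : {scalar V}).

Lemma convex_comb_lt (a b c p : R) :
  a < c -> b < c -> 0 <= p -> p <= 1 -> p * a + (1 - p) * b < c.
Proof. by move=> ac bc p0 p1; have [p2|p2] := leP p (1 / 2); nra. Qed.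

Lemma convex_halfspace_lt f (c : R) : convex_set [set x | f x < c].
Proof.
apply/convex_setP => x y p /= fx fy p0 p1.
by rewrite scalar_conv convex_comb_lt.
Qed.

Lemma convex_halfspace_ge f (c : R) : convex_set [set x | c <= f x].
Proof.
by apply/convex_setP => x y p /= fx fy p0 p1; rewrite scalar_conv; nra.
Qed.

Lemma convex_set_IVT A f (x y : V) (c : R) : convex_set A ->
  A x -> A y -> f x <= c -> c <= f y -> exists2 w, A w & f w = c.
Proof.
move=> /convex_setP cA Ax Ay fxc cfy.
have [fxy|fxy] := eqVneq (f x) (f y); first by exists x => //; lra.
have fxy_gt0 : 0 < f y - f x by move/eqP: fxy; lra.
exists ((c - f x) / (f y - f x) *: y + (1 - (c - f x) / (f y - f x)) *: x).
  apply: cA => //; first by apply: divr_ge0; lra.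
  by rewrite ler_pdivrMr // mul1r; lra.
by rewrite scalar_conv; field; rewrite gt_eqF.
Qed.

End Halfspaces.

Section Hulls.
Variables (R : realType) (n : nat).
Implicit Types (U V A : set 'rV[R]_n).

Lemma convex_conv_hull U : convex_set (conv_hull U).
Proof. by apply: convex_bigcap => A []. Qed.

Lemma sub_conv_hull U : U `<=` conv_hull U.
Proof. exact: sub_smallest. Qed.

Lemma conv_hull_min U A : convex_set A -> U `<=` A -> conv_hull U `<=` A.
Proof. exact: smallest_sub. Qed.

Lemma conv_hull_sub U V : U `<=` V -> conv_hull U `<=` conv_hull V.
Proof. by apply: sub_smallest2r; exact: convex_conv_hull. Qed.

Lemma conv_hull_exists_ge U (f : {scalar 'rV[R]_n}) (c : R) x :
  conv_hull U x -> c <= f x -> exists2 s, U s & c <= f s.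
Proof.
move=> Ux cfx; apply: contrapT => nU.
suff /(_ x Ux) : conv_hull U `<=` [set y | f y < c] by rewrite /= ltNge cfx.
apply: conv_hull_min => [|s Us]; first exact: convex_halfspace_lt.
by rewrite /= ltNge; apply/negP => cfs; apply: nU; exists s.
Qed.

Lemma trop_convex_tconv U : trop_convex (tconv U).
Proof.
move=> x y c d Ux Uy cd A UA; case: (UA) => tA _.
by apply: tA => //; [exact: Ux|exact: Uy].
Qed.

Lemma sub_tconv U : U `<=` tconv U.
Proof. exact: sub_smallest. Qed.

Lemma tconv_min U A : trop_convex A -> U `<=` A -> tconv U `<=` A.
Proof. exact: smallest_sub. Qed.

Lemma tconv_sub U V : U `<=` V -> tconv U `<=` tconv V.
Proof. by apply: sub_smallest2r; exact: trop_convex_tconv. Qed.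

End Hulls.

Section HomogeneousCoordinates.
Variables (R : realType) (n : nat).
Implicit Types (x y : 'rV[R]_n) (i j : 'I_n.+1).

(* [x] stands for the class of [(0, x_0, ..., x_(n-1))] modulo [trop_scale]. *)
Definition hcoord i x : R := oapp (x ord0) 0 (unlift ord0 i).

Definition hdiff i j x : R := hcoord j x - hcoord i x.

Lemma hcoord_is_scalar i : scalar (hcoord i).
Proof.
by move=> a x y; rewrite /hcoord; case: unlift => [j|] /=; rewrite ?mxE; ring.
Qed.

Lemma hdiff_is_scalar i j : scalar (hdiff i j).
Proof. by move=> a x y; rewrite /hdiff !hcoord_is_scalar; ring. Qed.

HB.instance Definition _ i j :=
  GRing.isLinear.Build R 'rV[R]_n R *%R (hdiff i j) (hdiff_is_scalar i j).

Lemma hcoord0 x : hcoord ord0 x = 0.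
Proof. by rewrite /hcoord unlift_none. Qed.

Lemma hcoord_lift0 (k : 'I_n) x : hcoord (lift ord0 k) x = x ord0 k.
Proof. by rewrite /hcoord liftK. Qed.

Lemma hcoord_inj x y : hcoord^~ x =1 hcoord^~ y -> x = y.
Proof. by move=> xy; apply/rowP => k; rewrite -!hcoord_lift0 xy. Qed.

Lemma hdiff_id i x : hdiff i i x = 0.
Proof. by rewrite /hdiff subrr. Qed.

Lemma hdiff_inj i x y : hdiff i ^~ x =1 hdiff i ^~ y -> x = y.
Proof.
move=> xy; apply: hcoord_inj => j.
by have := xy ord0; have := xy j; rewrite /hdiff !hcoord0; lra.
Qed.

Lemma hcoord_trop i (c d : R) x y : Num.min c d = 0 ->
  hcoord i (trop_add (trop_scale c x) (trop_scale d y)) =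
  Num.min (c + hcoord i x) (d + hcoord i y).
Proof.
move=> cd; case: (unliftP ord0 i) => [k|] ->.
  by rewrite !hcoord_lift0 !mxE.
by rewrite !hcoord0 !addr0.
Qed.

Lemma trop_convex_comb (T : set 'rV[R]_n) x y (c d : R) :
  trop_convex T -> T x -> T y ->
  exists2 q, T q & forall i j, hdiff i j q =
    Num.min (c + hcoord j x) (d + hcoord j y) -
    Num.min (c + hcoord i x) (d + hcoord i y).
Proof.
move=> tT Tx Ty; set e := Num.min c d.
have ed : Num.min (c - e) (d - e) = 0 by rewrite -addr_minl subrr.
exists (trop_add (trop_scale (c - e) x) (trop_scale (d - e) y)).
  exact: tT.
move=> i j; rewrite /hdiff !hcoord_trop // ![_ - e + _]addrAC -!addr_minl.
by ring.
Qed.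

End HomogeneousCoordinates.

Section Sectors.
Variables (R : realType) (n : nat).
Implicit Types (T U K : set 'rV[R]_n) (x y z s : 'rV[R]_n) (i j : 'I_n.+1).

Definition sector i z : set 'rV[R]_n :=
  [set s | forall j, hdiff i j z <= hdiff i j s].

Definition meets_sectors U : set 'rV[R]_n :=
  [set z | forall i, U `&` sector i z !=set0].

Lemma sector_conv i x y s t (p : R) : sector i x s -> sector i y t ->
  0 <= p -> p <= 1 ->
  sector i (p *: x + (1 - p) *: y) (p *: s + (1 - p) *: t).
Proof.
move=> xs yt p0 p1 j; rewrite !scalar_conv.
by have := xs j; have := yt j; nra.
Qed.

Lemma sub_meets_sectors U : U `<=` meets_sectors U.
Proof. by move=> x Ux i; exists x; split=> // j. Qed.

Lemma convex_meets_sectors K : convex_set K -> convex_set (meets_sectors K).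
Proof.
move=> /convex_setP cK; apply/convex_setP => x y p Kx Ky p0 p1 i.
have [s [Ks xs]] := Kx i; have [t [Kt yt]] := Ky i.
by exists (p *: s + (1 - p) *: t); split; [exact: cK|exact: sector_conv].
Qed.

Lemma trop_convex_meets_sectors U : trop_convex (meets_sectors U).
Proof.
move=> x y c d Ux Uy cd i; set z := trop_add _ _.
have hz j : hcoord j z = Num.min (c + hcoord j x) (d + hcoord j y).
  exact: hcoord_trop.
have hzx j : hcoord j z <= c + hcoord j x by rewrite hz ge_min lexx.
have hzy j : hcoord j z <= d + hcoord j y by rewrite hz ge_min lexx orbT.
have [hi|hi] : hcoord i z = c + hcoord i x \/ hcoord i z = d + hcoord i y.
  by rewrite hz; case: leP; [left|right].
- have [s [Us xs]] := Ux i; exists s; split=> // j.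
  by apply: le_trans (xs j); rewrite /hdiff hi; have := hzx j; lra.
- have [s [Us ys]] := Uy i; exists s; split=> // j.
  by apply: le_trans (ys j); rewrite /hdiff hi; have := hzy j; lra.
Qed.

Lemma meets_sectors_sub T : trop_convex T -> meets_sectors T `<=` T.
Proof.
move=> tT z Tz.
suff agree_on (l : seq 'I_n.+1) :
    exists w, [/\ T w, forall j, hcoord j z <= hcoord j w &
                  {in l, forall i, hcoord i w = hcoord i z}].
  have [w [Tw _ wz]] := agree_on (enum 'I_n.+1).
  by rewrite -(@hcoord_inj _ _ w z) // => i; apply: wz; rewrite mem_enum.
elim: l => [|i l [w [Tw zw wz]]].
  have [w [Tw zw]] := Tz ord0; exists w; split=> // j.
  by have := zw j; rewrite /hdiff !hcoord0 !subr0.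
have [s [Ts zs]] := Tz i; pose d := hcoord i z - hcoord i s.
have d_ge0 : 0 <= d by have := zs ord0; rewrite /hdiff !hcoord0 /d; lra.
exists (trop_add (trop_scale 0 w) (trop_scale d s)).
have d0 : Num.min 0 d = 0 by rewrite min_l.
have zsd j : hcoord j z <= d + hcoord j s.
  by have := zs j; rewrite /hdiff /d; lra.
split=> [|j|j]; first exact: tT.
  by rewrite hcoord_trop // add0r le_min zw zsd.
rewrite inE hcoord_trop // add0r => /orP[/eqP ->|/wz ->].
  by rewrite min_r // /d; [lra|have := zw i; lra].
by rewrite min_l.
Qed.

Lemma tconv_meets_sectors U : tconv U = meets_sectors U.
Proof.
apply/seteqP; split.
  apply: tconv_min (@sub_meets_sectors U).
  exact: trop_convex_meets_sectors.
apply: subset_trans (meets_sectors_sub (@trop_convex_tconv _ _ U)).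
by move=> z Uz i; have [s [/sub_tconv Us zs]] := Uz i; exists s.
Qed.

Lemma conv_hull_tconv_sub U : conv_hull (tconv U) `<=` tconv (conv_hull U).
Proof.
apply: conv_hull_min; last by apply: tconv_sub; exact: sub_conv_hull.
by rewrite tconv_meets_sectors; apply/convex_meets_sectors/convex_conv_hull.
Qed.

End Sectors.

Section Plane.
Variables (R : realType) (i : 'I_3).
Implicit Types (T U K : set 'rV[R]_2) (w x y z s : 'rV[R]_2).

Let j : 'I_3 := lift i ord0.
Let k : 'I_3 := lift i ord_max.

Lemma forall_ord3 (P : 'I_3 -> Prop) : P i -> P j -> P k -> forall l, P l.
Proof.
move=> Pi Pj Pk l; case: (unliftP i l) => [[[|[|//]] m2] ->|-> //].
  by rewrite (_ : Ordinal m2 = ord0) //; apply: val_inj.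
by rewrite (_ : Ordinal m2 = ord_max) //; apply: val_inj.
Qed.

Lemma mem_sector_plane z s : hdiff i j z <= hdiff i j s ->
  hdiff i k z <= hdiff i k s -> sector i z s.
Proof. by move=> ? ?; apply: forall_ord3; rewrite ?hdiff_id. Qed.

(* The line through [z] spanned by the [i]-th homogeneous unit vector. *)
Definition axis z : set 'rV[R]_2 := [set s | hdiff j k s = hdiff j k z].

Definition opposite_ray z : set 'rV[R]_2 :=
  axis z `&` [set s | hdiff i j s < hdiff i j z].

Definition sector_ray z : set 'rV[R]_2 := axis z `&` sector i z.

Lemma trop_convex_opposite_ray T z u v : trop_convex T -> T u -> T v ->
  hdiff i j u < hdiff i j z -> hdiff i k z <= hdiff i k u ->
  hdiff i j z <= hdiff i j v -> hdiff i k v < hdiff i k z ->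
  T `&` opposite_ray z !=set0.
Proof.
move=> tT Tu Tv uj uk vj vk.
have [q Tq hq] := trop_convex_comb (hcoord j z - hcoord j u)
  (hcoord k z - hcoord k v) tT Tu Tv.
have hj : Num.min (hcoord j z - hcoord j u + hcoord j u)
    (hcoord k z - hcoord k v + hcoord j v) = hcoord j z.
  by move: vj vk; rewrite /hdiff => *; rewrite min_l; lra.
have hk : Num.min (hcoord j z - hcoord j u + hcoord k u)
    (hcoord k z - hcoord k v + hcoord k v) = hcoord k z.
  by move: uj uk; rewrite /hdiff => *; rewrite min_r; lra.
exists q; split=> //; split; first by rewrite /axis /= hq hj hk.
rewrite /= hq hj ltrD2l ltrN2 lt_min.
by move: uj vk; rewrite /hdiff => *; apply/andP; split; lra.
Qed.

Lemma convex_mem_between_rays K z : convex_set K ->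
  K `&` opposite_ray z !=set0 -> K `&` sector_ray z !=set0 -> K z.
Proof.
move=> cK [q [Kq [qz qj]]] [w [Kw [wz zw]]].
have cKz : convex_set (K `&` axis z).
  by apply: convex_setI => //; exact: convex_hyperplane.
have [v [Kv vz] vj] :
    exists2 v, (K `&` axis z) v & hdiff i j v = hdiff i j z.
  by apply: (@convex_set_IVT _ _ _ _ q w) => //; exact: ltW.
rewrite -(@hdiff_inj _ _ i v z) //; apply: forall_ord3; rewrite ?hdiff_id //.
by move: vz vj; rewrite /axis /= /hdiff; lra.
Qed.

Lemma convex_meets_sector_ray K z x y l : convex_set K ->
  l != i -> K x -> K y ->
  hdiff i l z <= hdiff i l x -> hdiff i l z <= hdiff i l y ->
  hdiff j k x <= hdiff j k z -> hdiff j k z <= hdiff j k y ->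
  K `&` sector_ray z !=set0.
Proof.
move=> cK li Kx Ky zxl zyl xz zy.
have cKl : convex_set (K `&` [set s | hdiff i l z <= hdiff i l s]).
  by apply: convex_setI => //; exact: convex_halfspace_ge.
have [w [Kw zwl] wz] := convex_set_IVT cKl (conj Kx zxl) (conj Ky zyl) xz zy.
exists w; split=> //; split=> //; move: l li {cKl zxl zyl} zwl.
by apply: forall_ord3; rewrite ?eqxx //= => _ zwl; apply: mem_sector_plane;
  move: wz zwl; rewrite /= /hdiff; lra.
Qed.

Lemma segment_meets_sector_ray K z x y (p : R) : convex_set K ->
  K x -> K y -> 0 <= p -> p <= 1 ->
  hdiff i j x < hdiff i j z -> hdiff i k y < hdiff i k z ->
  sector i z (p *: x + (1 - p) *: y) -> K `&` sector_ray z !=set0.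
Proof.
move=> cK Kx Ky p0 p1 xj yk; set m := _ + _ => zm.
have Km : K m by move/convex_setP: (cK); apply.
have xk : hdiff i k z <= hdiff i k x.
  rewrite leNgt; apply/negP => xk; have := zm k.
  by rewrite scalar_conv leNgt convex_comb_lt.
have yj : hdiff i j z <= hdiff i j y.
  rewrite leNgt; apply/negP => yj; have := zm j.
  by rewrite scalar_conv leNgt convex_comb_lt.
have [mz|zm_lt] := leP (hdiff j k m) (hdiff j k z).
- apply: (convex_meets_sector_ray cK _ Km Kx (zm k) xk mz).
    by rewrite eq_sym neq_lift.
  by move: xj xk; rewrite /hdiff; lra.
- apply: (convex_meets_sector_ray cK _ Ky Km yj (zm j) _ (ltW zm_lt)).
    by rewrite eq_sym neq_lift.
  by move: yj yk; rewrite /hdiff; lra.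
Qed.

Lemma convex_setD_sector K z : convex_set K -> ~ K z ->
  K `&` opposite_ray z !=set0 -> convex_set (K `\` sector i z).
Proof.
move=> cK nKz Kopp.
have not_through_sector x y (p : R) : K x -> K y -> 0 <= p -> p <= 1 ->
    hdiff i j x < hdiff i j z -> hdiff i k y < hdiff i k z ->
    ~ sector i z (p *: x + (1 - p) *: y).
  move=> Kx Ky p0 p1 xj yk zm; apply: nKz.
  apply: convex_mem_between_rays => //.
  exact: segment_meets_sector_ray cK Kx Ky p0 p1 xj yk zm.
have outside x : ~ sector i z x ->
    hdiff i j x < hdiff i j z \/ hdiff i k x < hdiff i k z.
  move=> zx; have [zxj|] := leP (hdiff i j z) (hdiff i j x); last by left.
  have [zxk|] := leP (hdiff i k z) (hdiff i k x); last by right.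
  by case: zx; exact: mem_sector_plane.
apply/convex_setP => x y p [Kx /outside zx] [Ky /outside zy] p0 p1.
split; first by move/convex_setP: cK; apply.
case: zx zy => zx [] zy zm.
- by have := zm j; rewrite scalar_conv leNgt convex_comb_lt.
- exact: not_through_sector zm.
- apply: (not_through_sector y x (1 - p)) => //; [lra|lra|].
  by rewrite subKr addrC.
- by have := zm k; rewrite scalar_conv leNgt convex_comb_lt.
Qed.

Lemma conv_hull_meets_sector T z : trop_convex T -> ~ conv_hull T z ->
  conv_hull T `&` sector i z !=set0 -> T `&` sector i z !=set0.
Proof.
move=> tT nKz [s [Ks zs]]; apply: contrapT => nTz.
have T_outside x : T x -> hdiff i j z <= hdiff i j x ->
    ~ hdiff i k z <= hdiff i k x.
  by move=> Tx xj xk; apply: nTz; exists x; split=> //; exact: mem_sector_plane.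
have [v Tv vj] := conv_hull_exists_ge Ks (zs j).
have [u Tu uk] := conv_hull_exists_ge Ks (zs k).
have uj : hdiff i j u < hdiff i j z.
  by rewrite ltNge; apply/negP => /(T_outside u Tu).
have vk : hdiff i k v < hdiff i k z.
  by rewrite ltNge; apply/negP; exact: T_outside.
have [q [/sub_conv_hull Kq zq]] :=
  trop_convex_opposite_ray tT Tu Tv uj uk vj vk.
suff /(_ s Ks)[] : conv_hull T `<=` conv_hull T `\` sector i z by [].
apply: conv_hull_min => [|t Tt].
  by apply: convex_setD_sector => //; [exact: convex_conv_hull|exists q].
by split; [exact: sub_conv_hull|move=> zt; apply: nTz; exists t].
Qed.

End Plane.

Lemma tconv_conv_hull_sub (R : realType) (T : set 'rV[R]_2) :
  trop_convex T -> tconv (conv_hull T) `<=` conv_hull T.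
Proof.
move=> tT z; rewrite tconv_meets_sectors => Kz; apply: contrapT => nKz.
apply: (nKz); apply: sub_conv_hull; apply: meets_sectors_sub => // i.
exact: conv_hull_meets_sector.
Qed.

Theorem theorem1p10 (R : realType) (U : set 'rV[R]_2) :
  tconv (conv_hull U) = conv_hull (tconv U).
Proof.
apply/seteqP; split; last exact: conv_hull_tconv_sub.
apply: subset_trans (tconv_conv_hull_sub (@trop_convex_tconv _ _ U)).
by apply: tconv_sub; apply: conv_hull_sub; exact: sub_tconv.
Qed.
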